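(* Let $\mathcal{K}$ be a 2-category with 0-cells $\mathcal{C},\mathcal{D}$, 1-cells $F:\mathcal{C}\to\mathcal{D}$ and $G:\mathcal{D}\to\mathcal{C}$, and 2-cells $\eta:I\Rightarrow GF$ and $\epsilon:FG\Rightarrow I$. The following are equivalent: (1) $G\epsilon\circ\eta G=\mathrm{id}_G$ and $\epsilon F\circ F\eta=\mathrm{id}_F$; (2) $F$ is a terminal object in the rewrite category with objects the strings $F(GF)^n$ ($n\ge0$) and rules $\eta,\epsilon$, and $G$ is a terminal object in the rewrite category with objects the strings $G(FG)^n$ ($n\ge0$) and rules $\eta,\epsilon$; that is, for every $n\ge 0$ there is a derivation from $F(GF)^n$ to $F$ and any two such derivations have the same value, and for every $n\geq0$ there is a derivation from $G(FG)^n$ to $G$ and any two such derivations have the same value.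
   Context: Juxtaposition of 1-cells denotes composition, $I$ denotes the appropriate identity 1-cell, $\circ$ is vertical composition, and for 1-cells $A,B$ and a 2-cell $\phi$, $A\phi B$ is the whiskering of $\phi$ by the identity 2-cells of $A$ and $B$. Strings are alternating words in $F,G$ interpreted as composites of 1-cells. A reduction either inserts $GF$ at a position of a string $AB$ (giving $AGFB$, well-typed) with 2-cell $A\eta B$, or deletes an occurrence of $FG$ in a string $AFGB$ (giving $AB$) with 2-cell $A\epsilon B$. A derivation is a finite (possibly empty) sequence of reductions; its value is the vertical composite of the associated 2-cells (identity for the empty derivation). Morphisms of the rewrite category are values of derivations. *)

(* Defs.v *)
From Stdlib Require Import Utf8 ProofIrrelevance.

Set Implicit Arguments.
Unset Strict Implicit.
Unset Printing Implicit Defensive.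

Record Category := {
  obj :> Type;
  mor : obj -> obj -> Type;
  idm : forall x, mor x x;
  comp : forall x y z, mor y z -> mor x y -> mor x z;
  comp_idl : forall x y (f : mor x y), comp (idm y) f = f;
  comp_idr : forall x y (f : mor x y), comp f (idm x) = f;
  comp_assoc : forall w x y z (h : mor y z) (g : mor x y) (f : mor w x),
    comp (comp h g) f = comp h (comp g f)
}.
Arguments mor {c} _ _.
Arguments idm {c} _.
Arguments comp {c x y z} _ _.

Notation "f ⇒ g" := (mor f g) (at level 70, no associativity).
Notation "ψ ∘ φ" := (comp ψ φ) (at level 40, left associativity).

Definition is_terminal (A : Category) (t : A) : Prop :=
  forall x : A, exists f : x ⇒ t, forall g : x ⇒ t, g = f.

Definition cast (A : Category) (x x' y y' : A) (p : x = x') (q : y = y')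
    (f : x ⇒ y) : x' ⇒ y' :=
  match p in _ = u, q in _ = v return u ⇒ v with
  | eq_refl, eq_refl => f
  end.

(* The objects of [hom a b] are the 1-cells from [a] to [b], its morphisms are
   the 2-cells and [∘] is vertical composition.  [g • f] is "f, then g".
   Composition of 1-cells is associative and unital up to equality, so the
   corresponding laws for horizontal composition [⋆] of 2-cells are stated up
   to [cast] along these equalities. *)
Record TwoCategory := {
  cell0 :> Type;
  hom : cell0 -> cell0 -> Category;
  id1 : forall a, hom a a;
  comp1 : forall a b c, hom b c -> hom a b -> hom a c;
  hcomp : forall a b c (g g' : hom b c) (f f' : hom a b),
    g ⇒ g' -> f ⇒ f' -> comp1 g f ⇒ comp1 g' f';
  hcomp_idm : forall a b c (g : hom b c) (f : hom a b),
    hcomp (idm g) (idm f) = idm (comp1 g f);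
  interchange : forall a b c (g g' g'' : hom b c) (f f' f'' : hom a b)
      (ψ' : g' ⇒ g'') (ψ : g ⇒ g') (φ' : f' ⇒ f'') (φ : f ⇒ f'),
    hcomp (ψ' ∘ ψ) (φ' ∘ φ) = hcomp ψ' φ' ∘ hcomp ψ φ;
  comp1_idl : forall a b (f : hom a b), comp1 (id1 b) f = f;
  comp1_idr : forall a b (f : hom a b), comp1 f (id1 a) = f;
  comp1_assoc : forall a b c d (h : hom c d) (g : hom b c) (f : hom a b),
    comp1 (comp1 h g) f = comp1 h (comp1 g f);
  hcomp_idl : forall a b (f f' : hom a b) (φ : f ⇒ f'),
    cast (comp1_idl f) (comp1_idl f') (hcomp (idm (id1 b)) φ) = φ;
  hcomp_idr : forall a b (f f' : hom a b) (φ : f ⇒ f'),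
    cast (comp1_idr f) (comp1_idr f') (hcomp φ (idm (id1 a))) = φ;
  hcomp_assoc : forall a b c d (h h' : hom c d) (g g' : hom b c)
      (f f' : hom a b) (χ : h ⇒ h') (ψ : g ⇒ g') (φ : f ⇒ f'),
    cast (comp1_assoc h g f) (comp1_assoc h' g' f') (hcomp (hcomp χ ψ) φ)
      = hcomp χ (hcomp ψ φ)
}.
Arguments hom {t} _ _.
Arguments id1 {t} _.
Arguments comp1 {t a b c} _ _.
Arguments hcomp {t a b c g g' f f'} _ _.
Arguments comp1_idl {t a b} _.
Arguments comp1_idr {t a b} _.
Arguments comp1_assoc {t a b c d} _ _ _.

Notation "g • f" := (comp1 g f) (at level 35, right associativity).
Notation "ψ ⋆ φ" := (hcomp ψ φ) (at level 35, right associativity).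

Definition whisker (K : TwoCategory) (a b c d : K) (A : hom c d)
    (f g : hom b c) (φ : f ⇒ g) (B : hom a b) : A • f • B ⇒ A • g • B :=
  idm A ⋆ φ ⋆ idm B.

(* Strings are formal: they live over two formal 0-cells, so that nothing is
   assumed about coincidences among the cells of the 2-category (e.g. C = D).
   A string [word a b] is a path from [a] to [b]; typing forces alternation. *)
Inductive side := sC | sD.

Inductive letter : side -> side -> Type :=
| lF : letter sC sD
| lG : letter sD sC.

Inductive word (a : side) : side -> Type :=
| wnil : word a a
| wcons : forall b c, letter b c -> word a b -> word a c.
Arguments wnil {a}.
Arguments wcons {a b c} _ _.

Fixpoint app (a b c : side) (A : word b c) : word a b -> word a c :=
  match A in word _ c return word a b -> word a c with
  | wnil => fun B => B
  | wcons l A' => fun B => wcons l (app A' B)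
  end.

Fixpoint power (a : side) (w : word a a) (n : nat) : word a a :=
  match n with
  | 0 => wnil
  | S n' => app w (power w n')
  end.

Definition wF : word sC sD := wcons lF wnil.
Definition wG : word sD sC := wcons lG wnil.
Definition wGF : word sC sC := app wG wF.
Definition wFG : word sD sD := app wF wG.

Definition F_GF (n : nat) : word sC sD := app wF (power wGF n).
Definition G_FG (n : nat) : word sD sC := app wG (power wFG n).

(* The words from [sC] to [sD] are exactly the strings F(GF)^n, and those from
   [sD] to [sC] the strings G(FG)^n; hence reductions between words of one of
   these types never leave the corresponding family of strings. *)
Lemma word_form (a b : side) (w : word a b) :
  match a, b return word a b -> Prop with
  | sC, sC => fun w => exists n, w = power wGF n
  | sC, sD => fun w => exists n, w = F_GF n
  | sD, sC => fun w => exists n, w = G_FG n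
  | sD, sD => fun w => exists n, w = power wFG n
  end w.
Proof.
induction w as [|b c l w IH].
- destruct a; exists 0; reflexivity.
- destruct l, a; destruct IH as [n ->].
  + exists n; reflexivity.
  + exists (S n); reflexivity.
  + exists (S n); reflexivity.
  + exists n; reflexivity.
Qed.

Inductive reduction (a b : side) : word a b -> word a b -> Type :=
| insert_GF : forall (A : word sC b) (B : word a sC),
    reduction (app A B) (app A (app wGF B))
| delete_FG : forall (A : word sD b) (B : word a sD),
    reduction (app A (app wFG B)) (app A B).

Inductive derivation (a b : side) (T : word a b) : word a b -> Type :=
| dnil : derivation T T
| dcons : forall S S', reduction S S' -> derivation T S' -> derivation T S.
Arguments dnil {a b T}.
Arguments dcons {a b T S S'} _ _.

Notation "S ~~> T" := (derivation T S) (at level 70, no associativity).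

Fixpoint dapp (a b : side) (R S T : word a b) (d : R ~~> S) :
    S ~~> T -> R ~~> T :=
  match d in derivation _ R return S ~~> T -> R ~~> T with
  | dnil => fun e => e
  | dcons r d' => fun e => dcons r (dapp d' e)
  end.

Section Interpretation.

Variables (K : TwoCategory) (C D : K) (F : hom C D) (G : hom D C).
Variables (η : id1 C ⇒ G • F) (ε : F • G ⇒ id1 D).

Definition eval_side (s : side) : K :=
  match s with sC => C | sD => D end.

Definition eval_letter (a b : side) (l : letter a b) :
    hom (eval_side a) (eval_side b) :=
  match l with lF => F | lG => G end.

Fixpoint eval (a b : side) (w : word a b) : hom (eval_side a) (eval_side b) :=
  match w with
  | wnil => id1 (eval_side a)
  | wcons l w' => eval_letter l • eval w'
  end.

Lemma eval_app (a b c : side) (A : word b c) (B : word a b) :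
  eval (app A B) = eval A • eval B.
Proof.
induction A as [|c d l A IH]; simpl.
- symmetry; apply comp1_idl.
- rewrite IH; symmetry; apply comp1_assoc.
Qed.

Lemma eval_context_id (a b s : side) (A : word s b) (B : word a s) :
  eval A • id1 (eval_side s) • eval B = eval (app A B).
Proof. now rewrite eval_app, comp1_idl. Qed.

Lemma eval_context_GF (a b : side) (A : word sC b) (B : word a sC) :
  eval A • (G • F) • eval B = eval (app A (app wGF B)).
Proof. now rewrite eval_app; simpl; rewrite comp1_assoc. Qed.

Lemma eval_context_FG (a b : side) (A : word sD b) (B : word a sD) :
  eval A • (F • G) • eval B = eval (app A (app wFG B)).
Proof. now rewrite eval_app; simpl; rewrite comp1_assoc. Qed.

Definition reduction_cell (a b : side) (S T : word a b) (r : reduction S T) :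
    eval S ⇒ eval T :=
  match r with
  | insert_GF A B =>
      cast (eval_context_id (s := sC) A B) (eval_context_GF A B)
        (whisker (eval A) η (eval B))
  | delete_FG A B =>
      cast (eval_context_FG A B) (eval_context_id (s := sD) A B)
        (whisker (eval A) ε (eval B))
  end.

Fixpoint value (a b : side) (S T : word a b) (d : S ~~> T) : eval S ⇒ eval T :=
  match d with
  | dnil => idm (eval T)
  | dcons r d' => value d' ∘ reduction_cell r
  end.

Lemma value_dapp (a b : side) (R S T : word a b) (d : R ~~> S) (e : S ~~> T) :
  value (dapp d e) = value e ∘ value d.
Proof.
induction d as [|R R' r d IH]; simpl.
- symmetry; apply comp_idr.
- rewrite IH; apply comp_assoc.
Qed.

Definition is_value (a b : side) (S T : word a b) (φ : eval S ⇒ eval T) : Prop :=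
  exists d : S ~~> T, value d = φ.

Section RewriteCategory.

(* The index [n] stands for the string [str n]. *)
Variables (a b : side) (str : nat -> word a b).

Definition rewrite_mor (m n : nat) : Type :=
  {φ : eval (str m) ⇒ eval (str n) | is_value φ}.

Lemma rewrite_mor_eq (m n : nat) (f g : rewrite_mor m n) :
  proj1_sig f = proj1_sig g -> f = g.
Proof.
destruct f as [φ p], g as [ψ q]; simpl.
apply subset_eq_compat.
Qed.

Lemma is_value_idm (S : word a b) : is_value (idm (eval S)).
Proof. now exists dnil. Qed.

Lemma is_value_comp (R S T : word a b) (ψ : eval S ⇒ eval T)
  (φ : eval R ⇒ eval S) : is_value ψ -> is_value φ -> is_value (ψ ∘ φ).
Proof.
intros [e <-] [d <-]; exists (dapp d e); apply value_dapp.
Qed.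

Definition rewrite_category : Category.
Proof.
refine {|
  obj := nat;
  mor := rewrite_mor;
  idm n := exist _ (idm (eval (str n))) (is_value_idm (str n));
  comp l m n ψ φ :=
    exist _ (proj1_sig ψ ∘ proj1_sig φ)
      (is_value_comp (proj2_sig ψ) (proj2_sig φ))
|}; intros; apply rewrite_mor_eq; simpl.
- apply comp_idl.
- apply comp_idr.
- apply comp_assoc.
Defined.

Lemma is_terminal_rewriteE (t : nat) :
  is_terminal (A := rewrite_category) t <->
  forall n, inhabited (str n ~~> str t) /\
            forall d e : str n ~~> str t, value d = value e.
Proof.
split; intros H n; specialize (H n).
- destruct H as [[φ [c Hc]] H]; split; [exact (inhabits c)|].
  assert (U : forall d : str n ~~> str t, value d = φ).
  { intros d.
    exact (f_equal (@proj1_sig _ _) (H (exist _ (value d) (ex_intro _ d eq_refl)))). }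
  intros d e; now rewrite !U.
- destruct H as [[c] H].
  exists (exist _ (value c) (ex_intro _ c eq_refl)).
  intros [ψ [d <-]]; apply rewrite_mor_eq; apply H.
Qed.

End RewriteCategory.

Definition rewrite_category_F : Category := rewrite_category F_GF.
Definition rewrite_category_G : Category := rewrite_category G_FG.

(* The objects are indexed by n, and F = F(GF)^0, G = G(FG)^0. *)
Definition string_F : rewrite_category_F := 0.
Definition string_G : rewrite_category_G := 0.

Definition η_G : G ⇒ G • F • G :=
  cast (comp1_idl G) (comp1_assoc G F G) (η ⋆ idm G).
Definition G_ε : G • F • G ⇒ G :=
  cast eq_refl (comp1_idr G) (idm G ⋆ ε).

Definition F_η : F ⇒ F • G • F :=
  cast (comp1_idr F) eq_refl (idm F ⋆ η).
Definition ε_F : F • G • F ⇒ F :=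
  cast (comp1_assoc F G F) (comp1_idl F) (ε ⋆ idm F).

End Interpretation.

(* Main.v *)
From Stdlib Require Import ProofIrrelevance Setoid.
Require Import Defs.

(** A word ending in [D] is collapsed onto [I] or [F] by deleting its leftmost
    [FG] repeatedly, and a word ending in [C] is collapsed after putting [F] in
    front of it.  The triangle identity for [F] makes these collapsing 2-cells
    invariant under every reduction; since the collapsing 2-cell of [F] is the
    identity, a derivation to [F] has the collapsing 2-cell of its source as
    value.  A derivation to [G] is recovered from its whiskering by [F] through
    the mate correspondence, by the triangle identity for [G]. *)

Set Implicit Arguments.
Unset Strict Implicit.
Unset Printing Implicit Defensive.

(** * Equality of 2-cells up to equality of their endpoints *)

(** The transports are quantified existentially, so that chains of equations need not track the
    casts along the unit and associativity laws. *)
Definition heq (A : Category) (x y x' y' : A) (f : x ⇒ y) (g : x' ⇒ y') : Prop :=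
  exists (p : x = x') (q : y = y'), cast p q f = g.

Notation "f ≈ g" := (heq f g) (at level 70, no associativity).

Section HeterogeneousEquality.

Variable A : Category.

Lemma heq_refl (x y : A) (f : x ⇒ y) : f ≈ f.
Proof. now exists eq_refl, eq_refl. Qed.

Lemma heq_sym (x y x' y' : A) (f : x ⇒ y) (g : x' ⇒ y') : f ≈ g -> g ≈ f.
Proof. intros (p & q & <-); destruct p, q; apply heq_refl. Qed.

Lemma heq_trans (x y x' y' x'' y'' : A) (f : x ⇒ y) (g : x' ⇒ y')
  (h : x'' ⇒ y'') : f ≈ g -> g ≈ h -> f ≈ h.
Proof. intros (p & q & <-); destruct p, q; trivial. Qed.

Lemma eq_heq (x y : A) (f g : x ⇒ y) : f = g -> f ≈ g.
Proof. intros ->; apply heq_refl. Qed.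

(** Between parallel morphisms both endpoint equalities are reflexivity by proof irrelevance, so the
    cast vanishes. *)
Lemma heq_eq (x y : A) (f g : x ⇒ y) : f ≈ g -> f = g.
Proof.
intros (p & q & <-).
now rewrite (proof_irrelevance _ p eq_refl), (proof_irrelevance _ q eq_refl).
Qed.

Lemma heq_cast (x y x' y' : A) (p : x = x') (q : y = y') (f : x ⇒ y) :
  cast p q f ≈ f.
Proof. destruct p, q; apply heq_refl. Qed.

Lemma cast_heq (x y x' y' : A) (p : x = x') (q : y = y') (f : x ⇒ y)
  (g : x' ⇒ y') : cast p q f = g -> f ≈ g.
Proof. now exists p, q. Qed.

Lemma heq_idm (x y : A) : x = y -> idm x ≈ idm y.
Proof. intros ->; apply heq_refl. Qed.

Lemma heq_comp (x y z x' y' z' : A) (g : y ⇒ z) (f : x ⇒ y)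
  (g' : y' ⇒ z') (f' : x' ⇒ y') : g ≈ g' -> f ≈ f' -> g ∘ f ≈ g' ∘ f'.
Proof.
intros (p & q & <-) Hf; destruct p, q.
destruct Hf as (p & q & <-); destruct p.
(* [g] and [f] each bring an equality of the middle object; the two have to be identified. *)
rewrite (proof_irrelevance _ q eq_refl); apply heq_refl.
Qed.

End HeterogeneousEquality.

(** * Horizontal composition and whiskering *)

Section Horizontal.

Variable K : TwoCategory.

Lemma heq_hcomp (a b c : K) (g g' k k' : hom b c) (f f' h h' : hom a b)
  (ψ : g ⇒ g') (χ : k ⇒ k') (φ : f ⇒ f') (ω : h ⇒ h') :
  ψ ≈ χ -> φ ≈ ω -> ψ ⋆ φ ≈ χ ⋆ ω.
Proof.
intros (p & q & <-) (p' & q' & <-); destruct p, q, p', q'; apply heq_refl.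
Qed.

Lemma heq_hcompl (a b c : K) (g g' : hom b c) (f f' h h' : hom a b)
  (ψ : g ⇒ g') (φ : f ⇒ f') (ω : h ⇒ h') : φ ≈ ω -> ψ ⋆ φ ≈ ψ ⋆ ω.
Proof. apply heq_hcomp, heq_refl. Qed.

Lemma heq_hcompr (a b c : K) (g g' k k' : hom b c) (f f' : hom a b)
  (ψ : g ⇒ g') (χ : k ⇒ k') (φ : f ⇒ f') : ψ ≈ χ -> ψ ⋆ φ ≈ χ ⋆ φ.
Proof. intros H; apply heq_hcomp; [exact H | apply heq_refl]. Qed.

Lemma heq_hcomp_idl (a b : K) (f f' : hom a b) (φ : f ⇒ f') :
  idm (id1 b) ⋆ φ ≈ φ.
Proof. exact (cast_heq (hcomp_idl φ)). Qed.

Lemma heq_hcomp_idr (a b : K) (f f' : hom a b) (φ : f ⇒ f') :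
  φ ⋆ idm (id1 a) ≈ φ.
Proof. exact (cast_heq (hcomp_idr φ)). Qed.

Lemma heq_hcomp_assoc (a b c d : K) (h h' : hom c d) (g g' : hom b c)
  (f f' : hom a b) (χ : h ⇒ h') (ψ : g ⇒ g') (φ : f ⇒ f') :
  (χ ⋆ ψ) ⋆ φ ≈ χ ⋆ ψ ⋆ φ.
Proof. exact (cast_heq (hcomp_assoc χ ψ φ)). Qed.

Lemma whisker_compl (a b c : K) (g : hom b c) (f f' f'' : hom a b)
  (ψ : f' ⇒ f'') (φ : f ⇒ f') : idm g ⋆ (ψ ∘ φ) = idm g ⋆ ψ ∘ idm g ⋆ φ.
Proof. now rewrite <- interchange, comp_idl. Qed.

Lemma whisker_compr (a b c : K) (g g' g'' : hom b c) (f : hom a b)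
  (ψ : g' ⇒ g'') (φ : g ⇒ g') : (ψ ∘ φ) ⋆ idm f = ψ ⋆ idm f ∘ φ ⋆ idm f.
Proof. now rewrite <- interchange, comp_idl. Qed.

(** By interchange both sides equal [ψ ⋆ φ]. The naturality of [η] and [ε] comes from here. *)
Lemma whisker_exchange (a b c : K) (g g' : hom b c) (f f' : hom a b)
  (ψ : g ⇒ g') (φ : f ⇒ f') :
  ψ ⋆ idm f' ∘ idm g ⋆ φ = idm g' ⋆ φ ∘ ψ ⋆ idm f.
Proof. now rewrite <- !interchange, !comp_idl, !comp_idr. Qed.

End Horizontal.

(** * The 2-cells of reductions *)

Section Rewriting.

Variables (K : TwoCategory) (C D : K) (F : hom C D) (G : hom D C).
Variables (η : id1 C ⇒ G • F) (ε : F • G ⇒ id1 D).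

Local Notation eval := (eval F G).
Local Notation eval_side := (eval_side C D).
Local Notation cell := (reduction_cell η ε).

Lemma cell_insert_heq (a b : side) (A : word sC b) (B : word a sC) :
  cell (insert_GF A B) ≈ idm (eval A) ⋆ η ⋆ idm (eval B).
Proof. apply heq_cast. Qed.

Lemma cell_delete_heq (a b : side) (A : word sD b) (B : word a sD) :
  cell (delete_FG A B) ≈ idm (eval A) ⋆ ε ⋆ idm (eval B).
Proof. apply heq_cast. Qed.

Lemma cell_insert_nil_heq (a : side) (B : word a sC) :
  cell (insert_GF wnil B) ≈ η ⋆ idm (eval B).
Proof.
eapply heq_trans; [apply cell_insert_heq | apply heq_hcomp_idl].
Qed.

Lemma cell_delete_nil_heq (a : side) (B : word a sD) :
  cell (delete_FG wnil B) ≈ ε ⋆ idm (eval B).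
Proof.
eapply heq_trans; [apply cell_delete_heq | apply heq_hcomp_idl].
Qed.

(** One more letter of left context is one more whiskering on the left; this drives the induction on
    [A] in the invariance proof. *)
Lemma cell_insert_cons (a b c : side) (l : letter b c) (A : word sC b)
  (B : word a sC) :
  cell (insert_GF (wcons l A) B)
    = idm (eval_letter F G l) ⋆ cell (insert_GF A B).
Proof.
apply heq_eq.
eapply heq_trans; [apply cell_insert_heq|]; simpl.
rewrite <- hcomp_idm.
eapply heq_trans; [apply heq_hcomp_assoc|].
apply heq_hcompl, heq_sym, cell_insert_heq.
Qed.

Lemma cell_delete_cons (a b c : side) (l : letter b c) (A : word sD b)
  (B : word a sD) :
  cell (delete_FG (wcons l A) B)
    = idm (eval_letter F G l) ⋆ cell (delete_FG A B).
Proof.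
apply heq_eq.
eapply heq_trans; [apply cell_delete_heq|]; simpl.
rewrite <- hcomp_idm.
eapply heq_trans; [apply heq_hcomp_assoc|].
apply heq_hcompl, heq_sym, cell_delete_heq.
Qed.

(** Naturality of [ε]: once [F • G] is bracketed, [ε] and [φ] act on separate factors and can be
    exchanged. *)
Lemma cell_delete_natural (a : side) (X Y : word a sD) (φ : eval X ⇒ eval Y) :
  cell (delete_FG wnil Y) ∘ (idm F ⋆ idm G ⋆ φ)
    = φ ∘ cell (delete_FG wnil X).
Proof.
apply heq_eq.
eapply heq_trans.
{ apply heq_comp; [apply cell_delete_nil_heq|].
  eapply heq_sym, heq_trans; [|apply heq_hcomp_assoc].
  rewrite hcomp_idm; apply heq_refl. }
rewrite whisker_exchange.
apply heq_comp; [apply heq_hcomp_idl | apply heq_sym, cell_delete_nil_heq].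
Qed.

Lemma cell_insert_natural (a : side) (X Y : word a sC) (φ : eval X ⇒ eval Y) :
  cell (insert_GF wnil Y) ∘ φ
    = (idm G ⋆ idm F ⋆ φ) ∘ cell (insert_GF wnil X).
Proof.
apply heq_eq.
eapply heq_trans.
{ apply heq_comp; [apply cell_insert_nil_heq | apply heq_sym, heq_hcomp_idl]. }
rewrite whisker_exchange.
apply heq_comp; [|apply heq_sym, cell_insert_nil_heq].
rewrite <- hcomp_idm; apply heq_hcomp_assoc.
Qed.

(** Both factors are whiskered on the right by [eval B], which associativity and interchange pull
    out of the composite. *)
Lemma triangle_F_cell (a : side) (B : word a sC) :
  cell (delete_FG wnil (wcons lF B)) ∘ (idm F ⋆ cell (insert_GF wnil B))
    ≈ (ε_F ε ∘ F_η η) ⋆ idm (eval B).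
Proof.
rewrite whisker_compr.
apply heq_comp.
- eapply heq_trans; [apply cell_delete_nil_heq|]; simpl.
  rewrite <- hcomp_idm.
  eapply heq_trans; [apply heq_sym, heq_hcomp_assoc|].
  apply heq_hcompr, heq_sym, heq_cast.
- eapply heq_trans; [apply heq_hcompl, cell_insert_nil_heq|].
  eapply heq_trans; [apply heq_sym, heq_hcomp_assoc|].
  apply heq_hcompr, heq_sym, heq_cast.
Qed.

Lemma triangle_G_cell (a : side) (B : word a sD) :
  (idm G ⋆ cell (delete_FG wnil B)) ∘ cell (insert_GF wnil (wcons lG B))
    ≈ (G_ε ε ∘ η_G η) ⋆ idm (eval B).
Proof.
rewrite whisker_compr.
apply heq_comp.
- eapply heq_trans; [apply heq_hcompl, cell_delete_nil_heq|].
  eapply heq_trans; [apply heq_sym, heq_hcomp_assoc|].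
  apply heq_hcompr, heq_sym, heq_cast.
- eapply heq_trans; [apply cell_insert_nil_heq|]; simpl.
  rewrite <- hcomp_idm.
  eapply heq_trans; [apply heq_sym, heq_hcomp_assoc|].
  apply heq_hcompr, heq_sym, heq_cast.
Qed.

(** * Collapsing 2-cells and their invariance *)

Definition pad (x : K) (b : side) : hom x (eval_side b) -> hom x D :=
  match b with sC => fun f => F • f | sD => fun f => f end.

Definition pad_cell (x : K) (b : side) :
    forall f g : hom x (eval_side b), f ⇒ g -> pad f ⇒ pad g :=
  match b with sC => fun f g φ => idm F ⋆ φ | sD => fun f g φ => φ end.

Lemma pad_cell_idm (x : K) (b : side) (f : hom x (eval_side b)) :
  pad_cell (idm f) = idm (pad f).
Proof. destruct b; simpl; [apply hcomp_idm | reflexivity]. Qed.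

Lemma pad_cell_comp (x : K) (b : side) (f g h : hom x (eval_side b))
  (ψ : g ⇒ h) (φ : f ⇒ g) :
  pad_cell (ψ ∘ φ) = pad_cell ψ ∘ pad_cell φ.
Proof. destruct b; simpl; [apply whisker_compl | reflexivity]. Qed.

(** A leading [F] costs nothing, since it is exactly the padding of the rest; a leading [G] meets
    the padding [F] and is removed with it by [ε]. *)
Fixpoint collapse (a b : side) (w : word a b) :
    pad (eval w) ⇒ pad (id1 (eval_side a)) :=
  match w in word _ b
    return pad (b := b) (eval w) ⇒ pad (id1 (eval_side a)) with
  | wnil => idm _
  | wcons l w' =>
      match l in letter b c
        return forall w' : word a b,
          pad (eval w') ⇒ pad (id1 (eval_side a)) ->
          pad (b := c) (eval (wcons l w')) ⇒ pad (id1 (eval_side a)) with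
      | lF => fun w' e => e
      | lG => fun w' e => e ∘ cell (delete_FG wnil w')
      end w' (collapse w')
  end.

Definition collapse_invariant (a b : side) (X Y : word a b)
    (φ : eval X ⇒ eval Y) : Prop :=
  collapse Y ∘ pad_cell φ = collapse X.

(** For [F] both claims coincide by computation. For [G] the deletion of the leading [FG] must slide
    past [φ], which is naturality of [ε]. *)
Lemma collapse_invariant_cons (a b c : side) (l : letter b c) (X Y : word a b)
  (φ : eval X ⇒ eval Y) :
  collapse_invariant φ ->
  collapse_invariant (X := wcons l X) (Y := wcons l Y)
    (idm (eval_letter F G l) ⋆ φ).
Proof.
unfold collapse_invariant; destruct l; simpl; [trivial|].
intros <-.
rewrite !comp_assoc; f_equal; apply cell_delete_natural.
Qed.

Hypothesis triangle_F : ε_F ε ∘ F_η η = idm F.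

Lemma collapse_invariant_cell (a b : side) (X Y : word a b)
  (r : reduction X Y) : collapse_invariant (cell r).
Proof.
destruct r as [A B | A B].
- revert B; induction A as [|b c l A IH]; intros B.
  + unfold collapse_invariant; simpl.
    rewrite comp_assoc.
    rewrite <- comp_idr; f_equal; apply heq_eq.
    (* Collapsing [GFB] first deletes the padding [F] with the new [G]; after the insertion this is
       the triangle composite at [B]. *)
    eapply heq_trans; [apply triangle_F_cell|].
    rewrite triangle_F, hcomp_idm; apply heq_refl.
  + rewrite cell_insert_cons; exact (collapse_invariant_cons l (IH B)).
- revert B; induction A as [|b c l A IH]; intros B.
  (* Deleting a leading [FG] is the first step of the collapse by definition. *)
  + reflexivity.
  + rewrite cell_delete_cons; exact (collapse_invariant_cons l (IH B)).
Qed.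

Lemma collapse_invariant_value (a b : side) (X Y : word a b) (d : X ~~> Y) :
  collapse_invariant (value η ε d).
Proof.
unfold collapse_invariant.
induction d as [|X X' r d IH]; simpl.
- rewrite pad_cell_idm; apply comp_idr.
- rewrite pad_cell_comp, <- comp_assoc, IH.
  apply collapse_invariant_cell.
Qed.

Lemma value_to_F (X : word sC sD) (d : X ~~> wF) : value η ε d = collapse X.
Proof.
rewrite <- (collapse_invariant_value d); simpl.
symmetry; apply comp_idl.
Qed.

Hypothesis triangle_G : G_ε ε ∘ η_G η = idm G.

Lemma value_to_G (X : word sD sC) (d : X ~~> wG) :
  value η ε d = (idm G ⋆ collapse X) ∘ cell (insert_GF wnil X).
Proof.
rewrite <- (collapse_invariant_value d), whisker_compl, comp_assoc.
(* Naturality of [η] moves [value η ε d] to the right of the unit. *)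
etransitivity;
  [|exact (f_equal (comp _) (cell_insert_natural (value η ε d)))].
rewrite <- comp_assoc.
(* It remains that the mate of the collapse of [wG], which is [ε] up to units, is the identity: the
   triangle for [G]. *)
refine (eq_trans (eq_sym (comp_idl _)) _); f_equal.
simpl collapse; rewrite comp_idl.
apply heq_eq, heq_sym.
eapply heq_trans; [exact (triangle_G_cell wnil)|].
rewrite triangle_G, hcomp_idm; apply heq_refl.
Qed.

End Rewriting.

(** * Derivations to [F] and [G], and the zigzags *)

Fixpoint derivation_to_F (n : nat) : F_GF n ~~> F_GF 0 :=
  match n with
  | 0 => dnil
  | S n => dcons (delete_FG wnil (F_GF n)) (derivation_to_F n)
  end.

(** The [FG] just after the leading [G] is deleted, so that the remaining string is [G_FG n] by
    computation. *)
Fixpoint derivation_to_G (n : nat) : G_FG n ~~> G_FG 0 :=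
  match n with
  | 0 => dnil
  | S n => dcons (delete_FG wG (power wFG n)) (derivation_to_G n)
  end.

(** Compared with the empty derivation, this one turns uniqueness of values into the triangle
    identity. *)
Definition zigzag_F : F_GF 0 ~~> F_GF 0 :=
  dcons (insert_GF wF wnil) (dcons (delete_FG wnil wF) dnil).

Definition zigzag_G : G_FG 0 ~~> G_FG 0 :=
  dcons (insert_GF wnil wG) (dcons (delete_FG wG wnil) dnil).

Section Zigzag.

Variables (K : TwoCategory) (C D : K) (F : hom C D) (G : hom D C).
Variables (η : id1 C ⇒ G • F) (ε : F • G ⇒ id1 D).

Lemma value_zigzag_F : value η ε zigzag_F ≈ ε_F ε ∘ F_η η.
Proof.
(* The string [F] evaluates to [F • id1 C], so the triangle composite is first whiskered by
   [id1 C]. *)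
eapply heq_trans; [|apply heq_hcomp_idr].
eapply heq_trans; [|exact (triangle_F_cell η ε wnil)].
apply eq_heq.
refine (eq_trans (f_equal (fun φ => φ ∘ _) (comp_idl _)) _).
exact (f_equal (comp _) (cell_insert_cons η ε lF wnil wnil)).
Qed.

Lemma value_zigzag_G : value η ε zigzag_G ≈ G_ε ε ∘ η_G η.
Proof.
eapply heq_trans; [|apply heq_hcomp_idr].
eapply heq_trans; [|exact (triangle_G_cell η ε wnil)].
apply eq_heq.
refine (eq_trans (f_equal (fun φ => φ ∘ _) (comp_idl _)) _).
exact (f_equal (fun φ => φ ∘ _) (cell_delete_cons η ε lG wnil wnil)).
Qed.

End Zigzag.

Theorem theorem4p6 (K : TwoCategory) (C D : K) (F : hom C D) (G : hom D C)
    (η : id1 C ⇒ G • F) (ε : F • G ⇒ id1 D) :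
  (G_ε ε ∘ η_G η = idm G /\ ε_F ε ∘ F_η η = idm F)
  <->
  (is_terminal (string_F η ε) /\ is_terminal (string_G η ε)).
Proof.
unfold string_F, string_G, rewrite_category_F, rewrite_category_G.
rewrite !is_terminal_rewriteE.
split.
- intros [HG HF]; split; intros n; split.
  + exact (inhabits (derivation_to_F n)).
  + intros d e; now rewrite !(value_to_F HF).
  + exact (inhabits (derivation_to_G n)).
  + intros d e; now rewrite !(value_to_G HF HG).
- intros [HF HG]; split; apply heq_eq.
  + eapply heq_trans; [apply heq_sym, value_zigzag_G|].
    (* Uniqueness at [n = 0] gives the zigzag the value of the empty derivation, an identity. *)
    rewrite (proj2 (HG 0) zigzag_G dnil); apply heq_idm, comp1_idr.
  + eapply heq_trans; [apply heq_sym, value_zigzag_F|].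
    rewrite (proj2 (HF 0) zigzag_F dnil); apply heq_idm, comp1_idr.
Qed.
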